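(* Let $k>1$ and $n\ge k$ be natural numbers and let $r=\gcd(k,n)$. Then the rank of the edge-vertex incidence matrix $B_{C_n^k}$ of the $k$-uniform cycle $C_n^k$ is at most $n-r+1$.
   Context: A hypergraph $H$ is a pair $(V(H),E(H))$ with $V(H)$ a non-empty set (vertices) and $E(H)$ a set of non-empty subsets of $V(H)$ (hyperedges). The edge-vertex incidence matrix $B_H=[b_{ev}]_{e\in E(H),v\in V(H)}$ (considered over $\mathbb{C}$) has $b_{ev}=1$ if $v\in e$ and $b_{ev}=0$ otherwise. For $k\ge 2$ and $n\ge k$, the $k$-uniform cycle $C_n^k$ is the hypergraph with vertex set $\mathbb{Z}_n$ (integers modulo $n$) and hyperedge set $\{e_i: i\in\mathbb{Z}_n\}$, where $e_i=\{i,i+1,\ldots,i+(k-1)\}$ with addition in $\mathbb{Z}_n$. *)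

(* Defs.v *)
From HB Require Import structures.
From mathcomp Require Import all_boot all_order all_algebra.
From mathcomp Require Import reals.
From mathcomp.real_closed Require Import complex.

Set Implicit Arguments.
Unset Strict Implicit.
Unset Printing Implicit Defensive.

Import GRing.Theory.
Local Open Scope ring_scope.

(* Hypergraphs are finite, so that the incidence matrix is a matrix of
   finite size. *)
Record hypergraph := Hypergraph {
  hvertex : finType;
  hedges : {set {set hvertex}};
  hvertex_nonempty : (0 < #|hvertex|)%N;
  hedges_nonempty : forall e, e \in hedges -> e != set0
}.

(* Rows and columns are indexed by enumerations of the set of hyperedges and
   of the vertex type. *)
Definition incidence_mx (F : pzSemiRingType) (H : hypergraph) :
    'M[F]_(#|hedges H|, #|hvertex H|) :=
  \matrix_(i, j) ((enum_val j : hvertex H) \in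
                  (enum_val i : {set hvertex H}))%:R.

(* Meaningful for 1 < n only: 'Z_0 and 'Z_1 are the integers modulo 2. *)
Definition cycle_edge (n k : nat) (i : 'Z_n) : {set 'Z_n} :=
  [set i + j%:R | j : 'I_k].

(* This is a set of hyperedges: for n = k all the cycle_edge k i coincide, so
   the cycle has a single hyperedge. *)
Definition cycle_edges (n k : nat) : {set {set 'Z_n}} :=
  [set cycle_edge k i | i : 'Z_n].

Lemma Zn_nonempty (n : nat) : (0 < #|'Z_n|)%N.
Proof. by rewrite card_ord. Qed.

Lemma cycle_edges_nonempty (k n : nat) (hk : (1 < k)%N) (e : {set 'Z_n}) :
  e \in cycle_edges n k -> e != set0.
Proof.
case/imsetP=> i _ ->; apply/set0Pn; exists (i + 0%:R).
by apply/imsetP; exists (Ordinal (ltnW hk)).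
Qed.

(* hn is not needed to build the hypergraph, but together with hk it gives
   1 < n, so that 'Z_n is the intended vertex set. *)
Definition uniform_cycle (k n : nat) (hk : (1 < k)%N) (hn : (k <= n)%N) :
    hypergraph :=
  @Hypergraph 'Z_n (cycle_edges n k) (Zn_nonempty n)
    (@cycle_edges_nonempty k n hk).

(* Main.v *)
Require Import Defs.
From mathcomp Require Import all_boot all_order all_algebra.
From mathcomp Require Import reals.
From mathcomp.real_closed Require Import complex.

Local Open Scope ring_scope.

(** Colour the vertices of the cycle by their residues modulo r = gcd(k, n),
    which is consistent on Z_n since r divides n.  An edge is a window of k
    consecutive vertices, and k is a multiple of r, so sliding the window by
    one step removes and adds a vertex of the same colour: every edge contains
    the same number of vertices of a given colour.  Hence the incidence matrix
    B sends the r linearly independent indicator vectors of the colour classes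
    into the line spanned by the all-ones vector, and Sylvester's inequality
    rank B + r - n <= rank (B U), with U the matrix of these indicator vectors,
    gives the bound (lemma [rank_incidence_balanced]). *)

Import GRing.Theory.

(** Let U be the vertex-colour incidence matrix.  Every row of the product B U
    is the row of the m c, so B U has rank at most 1, while U has rank r; the
    bound is then Sylvester's inequality.  The section s makes the colour
    classes nonempty. *)
Lemma rank_incidence_balanced (F : fieldType) (H : hypergraph) (r : nat)
    (p : hvertex H -> 'I_r) (s : 'I_r -> hvertex H) (m : 'I_r -> nat) :
    cancel s p ->
    (forall e, e \in hedges H -> forall c, #|[set v in e | p v == c]| = m c) ->
  (\rank (incidence_mx F H) + r <= #|hvertex H| + 1)%N.
Proof.
move=> sK mE.
pose U : 'M[F]_(#|hvertex H|, r) := \matrix_(v, c) (p (enum_val v) == c)%:R.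
(* The rows of U at the representatives s c form the identity matrix. *)
have rankU : (r <= \rank U)%N.
  pose V : 'M[F]_(r, #|hvertex H|) := rowsub (fun c => enum_rank (s c)) 1%:M.
  apply: (@mulmx1_min_rank _ _ _ _ U V 1%:M); rewrite mulmx1 mul_rowsub_mx mul1mx.
  by apply/matrixP=> c d; rewrite !mxE enum_rankK sK.
have BU : incidence_mx F H *m U = const_mx 1 *m \row_c (m c)%:R :> 'M_(_, _).
  apply/matrixP=> e c; rewrite !mxE big_ord1 !mxE mul1r.
  rewrite -(mE _ (enum_valP e)) -sum1dep_card natr_sum.
  rewrite [RHS](reindex (@enum_val _ (hvertex H))) /=; last first.
    by apply: onW_bij; apply: enum_val_bij.
  rewrite [RHS]big_mkcond /=; apply: eq_bigr => v _.
  by rewrite !mxE -natrM mulnb; case: (_ && _).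
have rankBU : (\rank (incidence_mx F H *m U) <= 1)%N.
  by rewrite BU (leq_trans (mxrankM_maxr _ _)) ?rank_leq_row.
have := leq_trans (mxrank_mul_min (incidence_mx F H) U) rankBU.
rewrite leq_subLR; apply: leq_trans; exact: leq_add.
Qed.

Lemma sum_window_periodic (g : nat -> nat) (k i : nat) :
    (forall j, g (j + k)%N = g j) ->
  (\sum_(j < k) g (i + j) = \sum_(j < k) g j)%N.
Proof.
move=> gP; elim: i => // i <-; apply: (@addnI (g i)).
transitivity (\sum_(j < k.+1) g (i + j))%N.
  rewrite big_ord_recl addn0; congr (_ + _)%N.
  by apply: eq_bigr => j _; rewrite addSnnS.
by rewrite big_ord_recr /= gP addnC.
Qed.

(** The hypothesis k <= n ensures that the k vertices i + j are distinct, so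
    that counting the elements of an edge is summing over its positions j. *)
Lemma card_cycle_edge_residue (n k r c : nat) (i : 'Z_n) :
    (1 < n)%N -> (k <= n)%N -> (r %| n)%N ->
  #|[set v in cycle_edge k i | (v %% r == c)%N]|
    = (\sum_(j < k) ((i + j) %% r == c))%N.
Proof.
move=> n1 kn rn; rewrite -sum1dep_card big_mkcondr /= big_imset /=.
  apply: eq_bigr => j _.
  by rewrite val_Zp_nat // [X in (_ %% X %% r)%N]Zp_cast // modnDmr modn_dvdm.
move=> j1 j2 _ _ /addrI /(congr1 val); rewrite /= !val_Zp_nat //.
by rewrite !modn_small ?(leq_trans (ltn_ord _)) // => /val_inj.
Qed.

Theorem theorem2p8 (R : realType) (k n : nat)
    (hk : (1 < k)%N) (hn : (k <= n)%N) :
  (\rank (incidence_mx (complex R) (uniform_cycle hk hn))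
     <= n - gcdn k n + 1)%N.
Proof.
have n1 : (1 < n)%N := leq_trans hk hn.
set r := gcdn k n.
have r0 : (0 < r)%N by rewrite gcdn_gt0 (ltnW hk).
have rk : (r %| k)%N := dvdn_gcdl k n.
have rn : (r %| n)%N := dvdn_gcdr k n.
have le_rn : (r <= n)%N by rewrite dvdn_leq // ltnW.
pose p (v : 'Z_n) : 'I_r := Ordinal (ltn_pmod v r0).
pose s (c : 'I_r) : 'Z_n := (c : nat)%:R.
pose m (c : 'I_r) := (\sum_(j < k) (j %% r == c))%N.
have sK : cancel s p.
  move=> c; apply: val_inj; rewrite /= val_Zp_nat //.
  by rewrite modn_dvdm // modn_small.
have mE e : e \in cycle_edges n k ->
    forall c, #|[set v in e | p v == c]| = m c.
  case/imsetP=> i _ -> c; rewrite [LHS]card_cycle_edge_residue //.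
  apply: (@sum_window_periodic (fun j => (j %% r == c)%N : nat)) => j.
  by rewrite -modnDmr (eqP rk) addn0.
have cardV : #|hvertex (uniform_cycle hk hn)| = n by rewrite card_ord Zp_cast.
rewrite addnBAC // -(leq_add2r r) subnK ?(leq_trans le_rn) ?leq_addr //.
rewrite -[in X in (_ <= X)%N]cardV.
exact: (@rank_incidence_balanced (complex R) (uniform_cycle hk hn) r p s m).
Qed.
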